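(* Let $\mathcal{G}=\{G_1,G_2,\dots,G_k\}$ ($k\ge 1$) be a family of cycles on a common vertex set $V$, and let $n=|V|$. Then the following assertions hold: (1) If $n$ is odd, then $\operatorname{Sd}(\mathcal{G})=2$. (2) If $n$ is even, then $2\le \operatorname{Sd}(\mathcal{G})\le 3$. Moreover, for $n$ even, $\operatorname{Sd}(\mathcal{G})=2$ if and only if there are two distinct vertices $u,v\in V$ such that, for every $i\in\{1,\dots,k\}$, $u$ and $v$ are not mutually antipodal in $G_i$. (3) If $n$ is even and $k<n-1$, then $\operatorname{Sd}(\mathcal{G})=2$. Moreover, this is best possible in the sense that, for $n$ even, there is a family of $n-1$ cycles of order $n$ on the same vertex set whose simultaneous metric dimension is $3$.
   Context: All graphs are finite and simple. For a connected graph $G=(V,E)$, $d_G(x,y)$ denotes the length of a shortest path between $x$ and $y$ in $G$. A vertex $v$ resolves two vertices $x,y$ if $d_G(v,x)\ne d_G(v,y)$. A set $S\subseteq V$ is a metric generator for $G$ if every pair of distinct vertices of $G$ is resolved by some element of $S$. For a finite family $\mathcal{G}$ of connected graphs on a common vertex set $V$, a simultaneous metric generator for $\mathcal{G}$ is a set $S\subseteq V$ that is a metric generator for every graph in $\mathcal{G}$; the simultaneous metric dimension $\operatorname{Sd}(\mathcal{G})$ is the minimum cardinality of a simultaneous metric generator for $\mathcal{G}$. Each cycle in the family is a graph on the full vertex set $V$ isomorphic to the cycle $C_n$ (so $n\ge 3$). Two vertices $u,v$ of a connected graph $G$ are mutually antipodal in $G$ if $d_G(u,v)$ equals the diameter of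 $G$; in an even cycle every vertex has exactly one antipodal vertex. *)

(* Defs.v *)
From HB Require Import structures.
From mathcomp Require Import all_boot.

Set Implicit Arguments.
Unset Strict Implicit.
Unset Printing Implicit Defensive.

Record sgraph (V : finType) := SGraph {
  edges : {set {set V}};
  edges_card2 : [forall e in edges, #|e| == 2]
}.

(* [sgraph V] is itself a finite type, so a family of graphs on [V] can be an
   actual set [GG : {set sgraph V}], with [#|GG|] its number of members. *)
HB.instance Definition _ (V : finType) := [isSub for @edges V].
HB.instance Definition _ (V : finType) := [Finite of sgraph V by <:].

Definition adj (V : finType) (G : sgraph V) : rel V :=
  fun x y => [set x; y] \in edges G.

Definition rel_edges (V : finType) (r : rel V) : {set {set V}} :=
  [set e : {set V} | (#|e| == 2) &&
     [exists x, exists y, (e == [set x; y]) && r x y]].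

Lemma rel_edges_card2 (V : finType) (r : rel V) :
  [forall e in rel_edges r, #|e| == 2].
Proof. by apply/forall_inP => e; rewrite inE => /andP[]. Qed.

(* The simple graph underlying a relation: orientations and loops are dropped. *)
Definition graph_of_rel (V : finType) (r : rel V) : sgraph V :=
  SGraph (rel_edges_card2 r).

(* [ordS i] is [i + 1] modulo [n]; this is the n-cycle only for [n >= 3]. *)
Definition cycle_graph (n : nat) : sgraph 'I_n :=
  graph_of_rel (fun i j => j == ordS i).

Definition isomorphic (V W : finType) (G : sgraph V) (H : sgraph W) : Prop :=
  exists f : V -> W,
    bijective f /\ forall x y : V, adj G x y = adj H (f x) (f y).

Definition is_cycle (V : finType) (G : sgraph V) : Prop :=
  3 <= #|V| /\ isomorphic G (cycle_graph #|V|).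

Definition has_path (V : finType) (G : sgraph V) (x y : V) (d : nat) : bool :=
  [exists p : d.-tuple V,
     [&& path (adj G) x p, uniq (x :: p) & last x p == y]].

(* A path has fewer than [#|V|] edges, so this is the length of a shortest path;
   it takes the junk value [#|V|] when [x] and [y] are not connected. *)
Definition dist (V : finType) (G : sgraph V) (x y : V) : nat :=
  find (has_path G x y) (iota 0 #|V|).

Definition diameter (V : finType) (G : sgraph V) : nat :=
  \max_(x : V) \max_(y : V) dist G x y.

Definition mutually_antipodal (V : finType) (G : sgraph V) (u v : V) : bool :=
  dist G u v == diameter G.

Definition resolves (V : finType) (G : sgraph V) (v x y : V) : bool :=
  dist G v x != dist G v y.

Definition metric_generator (V : finType) (G : sgraph V) (S : {set V}) : bool :=
  [forall x, forall y, (x != y) ==> [exists v in S, resolves G v x y]].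

Definition sim_metric_generator (V : finType) (GG : {set sgraph V})
    (S : {set V}) : bool :=
  [forall G in GG, metric_generator G S].

(* [setT] is a legitimate default for the minimisation: see
   [sim_metric_generatorT] below. *)
Definition Sd (V : finType) (GG : {set sgraph V}) : nat :=
  #|[arg min_(S < [set: V] | sim_metric_generator GG S) #|S|]|.

Lemma dist_eq0 (V : finType) (G : sgraph V) (x y : V) :
  (dist G x y == 0) = (x == y).
Proof.
have V0 : 0 < #|V| by apply/card_gt0P; exists x.
rewrite /dist; case: #|V| V0 => // m _ /=.
have -> : has_path G x y 0 = (x == y).
  apply/existsP/idP => [[p]|xy]; first by rewrite (tuple0 p) => /and3P[].
  by exists [tuple].
by case: (x == y).
Qed.

Lemma sim_metric_generatorT (V : finType) (GG : {set sgraph V}) :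
  sim_metric_generator GG [set: V].
Proof.
apply/forall_inP => G _; apply/forallP => x; apply/forallP => y.
apply/implyP => xy; apply/existsP; exists x; rewrite inE /=.
apply: contraNneq xy => e.
by rewrite -(dist_eq0 G) -e dist_eq0.
Qed.

(* Main.v *)
Require Import Defs.
From HB Require Import structures.
From mathcomp Require Import all_boot zify.

Set Implicit Arguments.
Unset Strict Implicit.
Unset Printing Implicit Defensive.

(** Numbering the vertices of a cycle of order n consecutively by 0, ..., n - 1
    turns its graph distance into the circular distance min(d, n - d), where d
    is the difference of the two numbers ([dist_coord]).  Two distinct vertices
    a, b equidistant from u are then mirror images in the axis through u, that
    is a + b = 2u modulo n.  If a third vertex v does not separate them either,
    then 2u = 2v modulo n, so u = v or u and v are opposite, at distance n / 2.
    Conversely the two neighbours of u have the same distance to u and to the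
    vertex opposite to u.  Hence a set {u, v} is a metric generator of a cycle
    exactly when u and v are distinct and not opposite
    ([cycle_pair_generator]; the case u = v disposes of one-element sets), and
    the question becomes one about opposite pairs, of which there are none when
    n is odd.

    Each vertex has at most one opposite vertex in a given cycle.  So among any
    three vertices two are not opposite in a given cycle, whence the upper
    bound 3; and a fixed vertex u has fewer than n - 1 opposite vertices in a
    family of fewer than n - 1 cycles, which leaves some v forming with u a
    simultaneous metric generator ([few_cycles_common_pair]).

    For the extremal family of n - 1 cycles, take the round-robin tournament on
    n players: its n - 1 rounds are perfect matchings in which every two players
    meet once.  For each round, a cycle is drawn in which the matched players
    are opposite ([round_robin]).  Every pair is then opposite in some cycle,
    so that the dimension is 3. *)

(** * Circular distance *)

Definition cdist (n i j : nat) : nat :=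
  minn ((i - j) + (j - i)) (n - ((i - j) + (j - i))).

Lemma cdist_adj_lipschitz n i j k : i < n -> j < n -> k < n ->
  cdist n i j = 1 -> cdist n i k <= (cdist n j k).+1.
Proof. rewrite /cdist; lia. Qed.

(** One of the two neighbours of i on the circle is closer to k: this builds a
    walk of length [cdist n i k] from i to k. *)
Lemma cdist_step n i k : i < n -> k < n -> cdist n i k != 0 ->
  exists j, [/\ j < n, cdist n i j = 1 & cdist n j k = (cdist n i k).-1].
Proof.
move=> hi hk d0.
have ik : i != k by apply: contraNneq d0 => ->; rewrite /cdist subnn min0n.
case: (leqP i k) => lik; case: (leqP (2 * ((i - k) + (k - i))) n) => short.
(* The step goes up or down according to the side of the shorter arc. *)
- by exists i.+1; split; rewrite /cdist; lia.
- by case: (posnP i) => i0; [exists n.-1 | exists i.-1];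
    split; rewrite /cdist; lia.
- by exists i.-1; split; rewrite /cdist; lia.
- by case: (ltnP i.+1 n) => i1; [exists i.+1 | exists 0];
    split; rewrite /cdist; lia.
Qed.

Lemma cdist_half n i j : i < n -> j < n ->
  (2 * cdist n i j == n) = (2 * ((i - j) + (j - i)) == n).
Proof. by rewrite /cdist; case: (leqP i j); lia. Qed.

(** Distinct points equidistant from i are symmetric about i, i.e.
    a + b = 2 i modulo n; as all three are below n, only the multiples -n, 0
    and n can occur. *)
Lemma cdist_eq_mirror n i a b : i < n -> a < n -> b < n ->
  cdist n i a = cdist n i b -> a != b ->
  [\/ a + b = 2 * i, a + b = 2 * i + n | a + b + n = 2 * i].
Proof.
move=> hi ha hb e ab.
suff : [|| a + b == 2 * i, a + b == 2 * i + n | a + b + n == 2 * i].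
  by case/or3P => /eqP; [constructor 1|constructor 2|constructor 3].
move: e; rewrite /cdist; case: (leqP i a) => ?; case: (leqP i b) => ?; lia.
Qed.

(** Symmetry of a, b about both i and j gives 2 i = 2 j modulo n, which forces
    i = j or |i - j| = n / 2. *)
Lemma cdist_pair_inj n i j a b : i < n -> j < n -> a < n -> b < n ->
  i != j -> 2 * cdist n i j != n ->
  cdist n i a = cdist n i b -> cdist n j a = cdist n j b -> a = b.
Proof.
move=> hi hj ha hb ij; rewrite cdist_half // => half ei ej.
apply/eqP/negPn/negP => ab.
have := cdist_eq_mirror hi ha hb ei ab.
have := cdist_eq_mirror hj ha hb ej ab.
by case=> ? [] ?; lia.
Qed.

(** The twins are the two neighbours of i: the reflection that exchanges them
    fixes i and the point opposite to i. *)
Lemma cdist_twins n i : 2 < n -> i < n ->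
  exists a b, [/\ a < n, b < n, a != b, cdist n i a = cdist n i b &
    forall j, j < n -> 2 * cdist n i j = n -> cdist n j a = cdist n j b].
Proof.
move=> n2 hi.
have [a [b [ha hb ab mirror]]] : exists a b, [/\ a < n, b < n, a != b &
  [\/ a = i.+1 /\ i = b.+1, a = i.+1 /\ i = 0 /\ b.+1 = n
    | i.+1 = n /\ a = 0 /\ i = b.+1]].
  case: (ltnP i.+1 n) => i1; last first.
    by exists 0, i.-1; split; [lia..|constructor 3; lia].
  case: (posnP i) => i0; exists i.+1; [exists n.-1 | exists i.-1];
  by split; [lia | lia | lia | by [constructor 2; lia | constructor 1; lia]].
exists a, b; split=> // [|j hj /eqP]; last (rewrite cdist_half // => /eqP h);
  rewrite /cdist; case: mirror; lia.
Qed.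

(** * Cycles in coordinates *)

Lemma adj_graph_of_rel (V : finType) (r : rel V) x y :
  adj (graph_of_rel r) x y = (x != y) && (r x y || r y x).
Proof.
rewrite /adj inE cards2; case: (eqVneq x y) => //= xy.
apply/existsP/orP => [[a /existsP[b /andP[/eqP E rab]]]|[rxy|ryx]];
  last 2 first.
- by exists x; apply/existsP; exists y; rewrite eqxx.
- by exists y; apply/existsP; exists x; rewrite setUC eqxx.
have : a \in [set x; y] by rewrite E set21.
have : b \in [set x; y] by rewrite E set22.
have : x \in [set a; b] by rewrite -E set21.
have : y \in [set a; b] by rewrite -E set22.
rewrite !inE => /orP[]/eqP-> /orP[]/eqP e /orP[]/eqP e' /orP[]/eqP e''; subst;
 by move: xy rab; rewrite ?eqxx //; auto.
Qed.

(** The numberings of the vertices by 0, ..., #|V| - 1 in which adjacency means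
    being consecutive modulo #|V|: for at least three vertices, isomorphisms
    onto [cycle_graph] with values in [nat], where arithmetic is available. *)
Definition cyclic_coord (V : finType) (G : sgraph V) (f : V -> nat) : Prop :=
  [/\ injective f, forall x, f x < #|V| &
      forall x y, adj G x y = (cdist #|V| (f x) (f y) == 1)].

Lemma coord_surj (V : finType) (f : V -> nat) i :
  injective f -> (forall x, f x < #|V|) -> i < #|V| -> exists x, f x = i.
Proof.
move=> f_inj f_lt i_lt.
pose F x := Ordinal (f_lt x).
have F_inj : injective F by move=> x y /(congr1 val) /f_inj.
have [g _ gK] : bijective F by apply: inj_card_bij => //; rewrite card_ord.
by exists (g (Ordinal i_lt)); apply: (congr1 val (gK (Ordinal i_lt))).
Qed.

Lemma adj_cycle_graph n (i j : 'I_n) : 2 < n ->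
  adj (cycle_graph n) i j = (cdist n i j == 1).
Proof.
move=> n2; rewrite adj_graph_of_rel -!val_eqE /=.
have succ (k : 'I_n) : k.+1 %% n = if k.+1 < n then k.+1 else 0.
  have := ltn_ord k; case: (ltnP k.+1 n) => h k_lt; first by rewrite modn_small.
  by have -> : k.+1 = n by [lia]; rewrite modnn.
rewrite !succ; have := ltn_ord i; have := ltn_ord j.
by rewrite /cdist; case: (ltnP i.+1 n) => ?; case: (ltnP j.+1 n) => ?; lia.
Qed.

Lemma is_cycle_coord (V : finType) (G : sgraph V) :
  is_cycle G <-> 2 < #|V| /\ exists f, cyclic_coord G f.
Proof.
split=> [[V3 [F [F_bij adjF]]]|[V3 [f [f_inj f_lt adjf]]]]; split=> //.
  exists (fun x => F x : nat).
  split=> // [x y /val_inj /(bij_inj F_bij) //|x y].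
  by rewrite adjF adj_cycle_graph.
exists (fun x => Ordinal (f_lt x)); split=> [|x y].
  apply: inj_card_bij; last by rewrite card_ord.
  by move=> x y /(congr1 val) /f_inj.
by rewrite adj_cycle_graph // adjf.
Qed.

Definition cycle_along (V : finType) (f : V -> nat) : sgraph V :=
  graph_of_rel (fun x y => cdist #|V| (f x) (f y) == 1).

Lemma cycle_along_coord (V : finType) (f : V -> nat) :
  injective f -> (forall x, f x < #|V|) -> cyclic_coord (cycle_along f) f.
Proof.
move=> f_inj f_lt; split=> // x y.
have cC : cdist #|V| (f y) (f x) = cdist #|V| (f x) (f y).
  by rewrite /cdist addnC.
rewrite adj_graph_of_rel cC orbb; case: eqP => // ->.
by rewrite /cdist subnn min0n.
Qed.

(** [has_path] only sees paths without repetition; a walk of minimal length has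
    none, so that arbitrary walks may be used to compute distances. *)
Lemma dist_of_walks (V : finType) (G : sgraph V) x y m : m < #|V| ->
  (forall p, path (adj G) x p -> last x p = y -> m <= size p) ->
  (exists p, [/\ path (adj G) x p, last x p = y & size p = m]) ->
  dist G x y = m.
Proof.
move=> m_lt lower [p [xp py pm]]; rewrite /dist.
have no_short d : d < m -> has_path G x y d = false.
  move=> d_lt; apply/negbTE/existsP => -[q /and3P[xq _ /eqP qy]].
  by have := lower q xq qy; rewrite size_tuple leqNgt d_lt.
have has_m : has_path G x y m.
  (* Removing the loops of p cannot make it shorter than m. *)
  case/shortenP: xp py => q xq q_uniq q_sub qy.
  have q_size : size q == m.
    rewrite eqn_leq lower // andbT -pm.
    by case/andP: q_uniq => _ /uniq_leq_size; apply.
  by apply/existsP; exists (Tuple q_size); apply/and3P; split=> //; apply/eqP.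
have found : has (has_path G x y) (iota 0 #|V|).
  by apply/hasP; exists m; rewrite // mem_iota.
apply/eqP; rewrite eqn_leq; apply/andP; split; rewrite leqNgt; apply/negP => lt.
  by have := before_find 0 lt; rewrite nth_iota // has_m.
have := nth_find 0 found; rewrite nth_iota ?no_short //.
exact: ltn_trans m_lt.
Qed.

(** A walk changes the circular distance to its end by at most one per edge, and
    [cdist_step] provides a walk along which it decreases at every edge. *)
Lemma dist_coord (V : finType) (G : sgraph V) f : cyclic_coord G f ->
  forall u x, dist G u x = cdist #|V| (f u) (f x).
Proof.
case=> f_inj f_lt adjf u x; have [fu fx] := (f_lt u, f_lt x).
apply: dist_of_walks.
- by move: fu fx; rewrite /cdist; lia.
- move=> p; elim: p u {fu} => [|z p IH] u /=.
    by move=> _ ->; rewrite /cdist subnn min0n.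
  rewrite adjf => /andP[/eqP uz zp] zx.
  apply: leq_trans (cdist_adj_lipschitz (f_lt u) (f_lt z) fx uz) _.
  exact: IH.
have [m] := ubnP (cdist #|V| (f u) (f x)).
elim: m u {fu} => // m IH u; rewrite ltnS => le_m.
have [d0|d0] := eqVneq (cdist #|V| (f u) (f x)) 0.
  exists [::]; split=> //=; apply: f_inj.
  by move: (f_lt u) fx d0; rewrite /cdist; lia.
have [j [j_lt uj jx]] := cdist_step (f_lt u) fx d0.
have [z fz] := coord_surj f_inj f_lt j_lt; subst j.
have [|p [zp px p_size]] := IH z; first by rewrite jx; lia.
exists (z :: p); split=> //=; first by rewrite adjf uj zp.
by rewrite p_size jx prednK ?lt0n.
Qed.

(** The neighbours of u are resolved neither by u nor by the vertex opposite to
    u, and [cdist_pair_inj] leaves no other obstruction.  The equality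
    2 * dist = #|V| expresses opposite vertices without parity assumption: it
    never holds in an odd cycle.  The case u = v says that single vertices do
    not generate. *)
Lemma cycle_pair_generator (V : finType) (G : sgraph V) u v : is_cycle G ->
  metric_generator G [set u; v] = (u != v) && (2 * dist G u v != #|V|).
Proof.
case/is_cycle_coord => V3 [f fG]; have [f_inj f_lt _] := fG.
have dE := dist_coord fG.
apply/idP/andP => [gen|[uv half]].
  have [i [j [i_lt j_lt ij ui vi]]] := cdist_twins V3 (f_lt u).
  have [a fa] := coord_surj f_inj f_lt i_lt.
  have [b fb] := coord_surj f_inj f_lt j_lt; subst i j.
  have ab : a != b by apply: contraNneq ij => ->.
  move/forallP/(_ a)/forallP/(_ b): gen; rewrite ab /= => /existsP[w].
  rewrite !inE /resolves !dE => /andP[/orP[]/eqP->]; first by rewrite ui eqxx.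
  move=> vab; have [uv|uv] := eqVneq u v; first by rewrite -uv ui eqxx in vab.
  by split=> //; apply: contraNneq vab => /(vi _ (f_lt v)) ->.
apply/forallP => a; apply/forallP => b; apply/implyP => ab.
apply/existsP; have [ua|] := boolP (resolves G u a b).
  by exists u; rewrite set21.
rewrite negbK !dE => /eqP ua.
exists v; rewrite set22 /resolves !dE /=; apply: contraNneq ab => va.
rewrite -(inj_eq f_inj); apply/eqP.
apply: (@cdist_pair_inj _ (f u) (f v)) => //; first by rewrite inj_eq.
by rewrite -dE.
Qed.

Lemma even_cycle_antipodal (V : finType) (G : sgraph V) u v :
  is_cycle G -> ~~ odd #|V| ->
  mutually_antipodal G u v = (2 * dist G u v == #|V|).
Proof.
case/is_cycle_coord => V3 [f fG] V_even; have [f_inj f_lt _] := fG.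
have dE := dist_coord fG.
suff diam : diameter G = #|V|./2.
  by rewrite /mutually_antipodal diam; lia.
apply/eqP; rewrite eqn_leq; apply/andP; split.
  apply/bigmax_leqP => x _; apply/bigmax_leqP => y _.
  by rewrite dE; move: (f_lt x) (f_lt y); rewrite /cdist; lia.
have [|x fx] := coord_surj (i := 0) f_inj f_lt; first by lia.
have [|y fy] := coord_surj (i := #|V|./2) f_inj f_lt; first by lia.
apply: leq_trans (leq_bigmax x); apply: leq_trans (leq_bigmax y).
by rewrite dE fx fy /cdist; lia.
Qed.

Lemma antipode_unique (V : finType) (G : sgraph V) u v w : is_cycle G ->
  2 * dist G u v = #|V| -> 2 * dist G u w = #|V| -> v = w.
Proof.
case/is_cycle_coord => V3 [f fG]; have [f_inj f_lt _] := fG.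
rewrite !(dist_coord fG) => /eqP; rewrite cdist_half // => /eqP uv.
move=> /eqP; rewrite cdist_half // => /eqP uw; apply: f_inj.
by move: (f_lt u) (f_lt v) (f_lt w); lia.
Qed.

(** * Simultaneous metric dimension of families of cycles *)

Lemma metric_generatorS (V : finType) (G : sgraph V) (S T : {set V}) :
  S \subset T -> metric_generator G S -> metric_generator G T.
Proof.
move=> /subsetP ST /forallP gen.
apply/forallP => x; apply/forallP => y; apply/implyP => xy.
have /existsP[v /andP[vS vxy]] := implyP (forallP (gen x) y) xy.
by apply/existsP; exists v; rewrite ST.
Qed.

Lemma Sd_le (V : finType) (GG : {set sgraph V}) S :
  sim_metric_generator GG S -> Sd GG <= #|S|.
Proof.
rewrite /Sd; case: arg_minnP => [|T _ minT /minT //].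
exact: sim_metric_generatorT.
Qed.

Lemma Sd_attained (V : finType) (GG : {set sgraph V}) :
  exists2 S, sim_metric_generator GG S & #|S| = Sd GG.
Proof.
rewrite /Sd; case: arg_minnP => [|S genS _]; last by exists S.
exact: sim_metric_generatorT.
Qed.

Lemma Sd_cycles_ge2 (V : finType) (GG : {set sgraph V}) G :
  G \in GG -> is_cycle G -> 1 < Sd GG.
Proof.
move=> GGG G_cycle; have [S /forall_inP/(_ G GGG) genS <-] := Sd_attained GG.
rewrite ltnNge; apply/negP => S1.
have [u Su] : exists u, S \subset [set u; u].
  have [S0|[u uS]] := set_0Vmem S.
    have /card_gt0P[u _] : 0 < #|V| by case: G_cycle => /ltnW/ltnW.
    by exists u; rewrite S0 sub0set.
  exists u; rewrite setUid; apply/subsetP => v.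
  by rewrite (card_le1P S1 u uS v) inE.
by have := metric_generatorS Su genS; rewrite cycle_pair_generator ?eqxx.
Qed.

Lemma Sd_cycles_eq2 (V : finType) (GG : {set sgraph V}) :
  GG != set0 -> (forall G, G \in GG -> is_cycle G) ->
  Sd GG = 2 <->
  exists u v, u != v /\ forall G, G \in GG -> 2 * dist G u v != #|V|.
Proof.
case/set0Pn => G0 GG0 GG_cycle; split=> [Sd2|[u [v [uv half]]]].
  have [S /forall_inP genS /eqP] := Sd_attained GG.
  rewrite Sd2 => /cards2P[u [v [uv SE]]]; subst S.
  exists u, v; split=> // G GGG.
  by have := genS G GGG; rewrite cycle_pair_generator ?uv //; apply: GG_cycle.
apply/eqP; rewrite eqn_leq (Sd_cycles_ge2 GG0) ?andbT; last exact: GG_cycle.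
have <- : #|[set u; v]| = 2 by rewrite cards2 uv.
apply: Sd_le; apply/forall_inP => G GGG.
by rewrite cycle_pair_generator ?uv ?half //; apply: GG_cycle.
Qed.

(** Any three vertices x, y, z will do: in each cycle, if y is opposite to x
    then z is not. *)
Lemma Sd_cycles_le3 (V : finType) (GG : {set sgraph V}) :
  2 < #|V| -> (forall G, G \in GG -> is_cycle G) -> Sd GG <= 3.
Proof.
case/card_gt2P => x [y [z [_ [xy yz zx]]]] GG_cycle.
have <- : #|[set x; y; z]| = 3.
  by rewrite setUC cardsU1 cards2 xy !inE negb_or zx eq_sym yz.
apply: Sd_le; apply/forall_inP => G /GG_cycle G_cycle.
have [xyG|] := boolP (2 * dist G x y != #|V|).
  apply: (@metric_generatorS _ _ [set x; y]); first exact: subsetUl.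
  by rewrite cycle_pair_generator ?xy.
rewrite negbK => /eqP xyG.
apply: (@metric_generatorS _ _ [set x; z]).
  by apply/subsetP => w; rewrite !inE => /orP[]->; rewrite ?orbT.
rewrite cycle_pair_generator // eq_sym zx /=; apply: contraNneq yz => xzG.
exact/eqP/(antipode_unique G_cycle xyG).
Qed.

(** A fixed vertex u and its opposite vertices in the members of GG do not
    exhaust V; any remaining vertex can be paired with u. *)
Lemma few_cycles_common_pair (V : finType) (GG : {set sgraph V}) :
  (forall G, G \in GG -> is_cycle G) -> #|GG| < #|V| - 1 ->
  exists u v, u != v /\ forall G, G \in GG -> 2 * dist G u v != #|V|.
Proof.
move=> GG_cycle few.
have /card_gt0P[u _] : 0 < #|V| by lia.
pose antipode G := odflt u [pick v | 2 * dist G u v == #|V|].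
pose A := u |: [set antipode G | G in GG].
have A_small : #|A| < #|V|.
  rewrite cardsU1.
  apply: leq_ltn_trans (leq_add (leq_b1 _) (leq_imset_card _ _)) _.
  by rewrite -ltn_subRL.
have /subsetPn[v _ vA] : ~~ ([set: V] \subset A).
  by apply/negP => /subset_leq_card; rewrite cardsT leqNgt A_small.
exists u, v; split=> [|G GGG].
  by apply: contraNneq vA => <-; rewrite setU11.
apply: contraNneq vA => vG; rewrite !inE; apply/orP; right; apply/imsetP.
exists G => //; rewrite /antipode; case: pickP => [w /eqP wG|/(_ v)] /=.
  exact: antipode_unique (GG_cycle G GGG) vG wG.
by rewrite vG eqxx.
Qed.

(** * A family of n - 1 cycles in which all pairs are opposite *)

(** The circle method for scheduling a round-robin tournament: the players
    0, ..., n - 2 form the integers modulo n - 1 and n - 1 is an extra player.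
    In round r the extra player meets r, and r + s meets r - s for
    0 < s < n / 2.  The function places the players on a circle of n seats so
    that opponents face each other: r at 0, the extra player at n / 2, r + s
    at s and r - s at n / 2 + s. *)
Definition round_robin (n r x : nat) : nat :=
  if x == n.-1 then n./2 else
  let t := if r <= x then x - r else x + n.-1 - r in
  if t < n./2 then t else n + n./2 - 1 - t.

Lemma round_robin_lt n r x : 2 < n -> ~~ odd n -> r < n.-1 -> x < n ->
  round_robin n r x < n.
Proof.
rewrite /round_robin => n2 n_even r_lt x_lt.
by case: eqP => _; [|case: (leqP r x) => ? /=; case: (ltnP _ n./2) => ?]; lia.
Qed.

Lemma round_robin_inj n r x y : 2 < n -> ~~ odd n -> r < n.-1 ->
  x < n -> y < n -> round_robin n r x = round_robin n r y -> x = y.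
Proof.
rewrite /round_robin => n2 n_even r_lt x_lt y_lt.
by case: (eqVneq x n.-1) => ?; case: (eqVneq y n.-1) => ?;
  case: (leqP r x) => ? /=; case: (leqP r y) => ? /=;
  do 2?[case: (ltnP _ n./2) => ?]; lia.
Qed.

(** Ordinary players x and y meet in the round r with 2 r = x + y modulo n - 1,
    which is solvable since n - 1 is odd. *)
Lemma round_robin_meet n x y : 2 < n -> ~~ odd n -> x < y -> y < n ->
  exists2 r, r < n.-1 &
    2 * cdist n (round_robin n r x) (round_robin n r y) = n.
Proof.
move=> n2 n_even xy y_lt.
suff [r r_lt H] : exists2 r, r < n.-1 &
    round_robin n r y = round_robin n r x + n./2 \/
    round_robin n r x = round_robin n r y + n./2.
  exists r => //; apply/eqP; rewrite cdist_half ?round_robin_lt //; try lia.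
have [yN|yN] := eqVneq y n.-1.
  exists x; rewrite /round_robin ?leqnn ?subnn; first by lia.
  rewrite yN eqxx; have -> : (x == n.-1) = false by lia.
  by case: (ltnP _ n./2); lia.
have xN : (x == n.-1) = false by lia.
have [r rE] : exists r, r < n.-1 /\ (2 * r = x + y \/
    2 * r = x + y + n.-1 \/ 2 * r + n.-1 = x + y).
  case: (boolP (odd (x + y))) => xy_odd; last by exists (x + y)./2; lia.
  case: (ltnP (x + y) n.-1) => ?; last by exists (x + y - n.-1)./2; lia.
  by exists (x + y + n.-1)./2; lia.
exists r; first by case: rE.
rewrite /round_robin xN (negbTE yN).
by move: rE; case: (leqP r x) => ? /=; case: (leqP r y) => ? /=;
  do 2?[case: (ltnP _ n./2) => ?]; lia.
Qed.

Lemma ex_cycle_family_Sd3 (V : finType) : 2 < #|V| -> ~~ odd #|V| ->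
  exists HH : {set sgraph V}, [/\ #|HH| = #|V| - 1,
    forall G, G \in HH -> is_cycle G & Sd HH = 3].
Proof.
move=> V3 V_even; pose h (x : V) : nat := enum_rank x.
have h_lt x : h x < #|V| by apply: ltn_ord.
have h_inj : injective h by move=> x y /val_inj /enum_rank_inj.
pose f (r : 'I_#|V|.-1) x := round_robin #|V| r (h x).
have f_inj r : injective (f r) by move=> x y /round_robin_inj /h_inj; apply.
have f_lt r x : f r x < #|V| by apply: round_robin_lt.
have fG r := cycle_along_coord (f_inj r) (f_lt r).
pose HH := [set cycle_along (f r) | r : 'I_#|V|.-1].
have HH_cycle G : G \in HH -> is_cycle G.
  by case/imsetP => r _ ->; apply/is_cycle_coord; split=> //; exists (f r).
have r0_lt : 0 < #|V|.-1 by lia.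
have HH0 : cycle_along (f (Ordinal r0_lt)) \in HH by apply: imset_f.
have HH_ne0 : HH != set0 by apply/set0Pn; eexists; exact: HH0.
have meet x y : h x < h y -> exists2 G, G \in HH &
    2 * dist G x y = #|V| /\ 2 * dist G y x = #|V|.
  move=> xy; have [r r_lt m] := round_robin_meet V3 V_even xy (h_lt y).
  exists (cycle_along (f (Ordinal r_lt))); first exact: imset_f.
  rewrite !(dist_coord (fG _)) /f /=; split; first exact: m.
  by move: m; rewrite /cdist addnC.
have no_pair : ~ exists u v, u != v /\
    forall G, G \in HH -> 2 * dist G u v != #|V|.
  move=> [u [v [uv far]]].
  have : h u != h v by rewrite (inj_eq h_inj).
  rewrite neq_ltn => /orP[] /meet[G /far] H [e1 e2]; move: H;
  by rewrite ?e1 ?e2 eqxx.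
exists HH; split=> //.
  apply/eqP; rewrite eqn_leq; apply/andP; split.
    by apply: leq_trans (leq_imset_card _ _) _; rewrite card_ord subn1.
  (* The rounds give distinct cycles, since a smaller family would leave a pair
     that is opposite in none of them. *)
  rewrite leqNgt; apply/negP => few.
  exact: no_pair (few_cycles_common_pair HH_cycle few).
have ne2 : Sd HH <> 2 by move=> /Sd_cycles_eq2 -/(_ HH_ne0 HH_cycle).
have := Sd_cycles_le3 V3 HH_cycle.
have := Sd_cycles_ge2 HH0 (HH_cycle _ HH0).
by lia.
Qed.

Theorem theorem3p3 (V : finType) (n : nat) (hn : #|V| = n) :
  (forall (k : nat) (GG : {set sgraph V}),
     1 <= k -> #|GG| = k ->
     (forall G : sgraph V, G \in GG -> is_cycle G) ->
     [/\ odd n -> Sd GG = 2,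
         ~~ odd n ->
           2 <= Sd GG <= 3 /\
           (Sd GG = 2 <->
            exists u v : V, u <> v /\
              forall G : sgraph V, G \in GG -> ~~ mutually_antipodal G u v)
       & ~~ odd n -> k < n - 1 -> Sd GG = 2]) /\
  (3 <= n -> ~~ odd n ->
   exists HH : {set sgraph V},
     [/\ #|HH| = n - 1,
         forall G : sgraph V, G \in HH -> is_cycle G
       & Sd HH = 3]).
Proof.
subst n; split=> [k GG k0 GGk GG_cycle|V3 V_even]; last first.
  exact: ex_cycle_family_Sd3.
subst k; have [G0 GG0] := card_gt0P k0.
have V3 : 2 < #|V| by case: (GG_cycle G0 GG0).
have GG_ne0 : GG != set0 by apply/set0Pn; exists G0.
have eq2 := Sd_cycles_eq2 GG_ne0 GG_cycle.
split=> [V_odd|V_even|V_even few].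
- have /card_gt1P[u [v [_ _ uv]]] := ltnW V3.
  apply/eq2; exists u, v; split=> // G _.
  by apply: contraTneq V_odd => <-; rewrite oddM.
- split.
    by rewrite (Sd_cycles_ge2 GG0) ?Sd_cycles_le3 //; apply: GG_cycle.
  rewrite eq2; split=> -[u [v [/eqP uv far]]]; exists u, v; split=> // G GGG.
    by rewrite even_cycle_antipodal ?far //; apply: GG_cycle.
  by rewrite -even_cycle_antipodal ?far //; apply: GG_cycle.
- exact/eq2/few_cycles_common_pair.
Qed.
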